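(* Let $n\ge1$ and $\mathbf{A}=\mathbb{Z}[\frac12][v,v^{-1}]$. For each $\sigma\in S_n$ and each $I\subseteq\{1,\ldots,n\}$ with $|I|$ even, there exist $f_{\sigma,I;\nu}\in\mathbf{A}$ ($\nu\in\mathcal{OP}_n$) such that $$T_{\sigma}C_I\equiv\sum_{\nu\in\mathcal{OP}_n}f_{\sigma,I;\nu}\,T_{w_\nu}\mod [\mathcal{H}^c_{n,\mathbf{A}},\mathcal{H}^c_{n,\mathbf{A}}]_{\bar 0}.$$
   Context: Hecke-Clifford algebra. Let $v$ be an indeterminate. $\mathcal{H}_n^c$ is the associative superalgebra over $\mathbb{C}(v^{1/2})$ with even generators $T_1,\ldots,T_{n-1}$ and odd generators $c_1,\ldots,c_n$ and relations: $(T_i-v)(T_i+1)=0$; $T_iT_j=T_jT_i$ for $|i-j|>1$; $T_iT_{i+1}T_i=T_{i+1}T_iT_{i+1}$; $c_i^2=1$, $c_ic_j=-c_jc_i$ for $i\ne j$; $T_ic_j=c_jT_i$ for $j\neq i,i+1$; $T_ic_i=c_{i+1}T_i$. $\mathcal{H}^c_{n,\mathbf{A}}$ is the $\mathbf{A}$-subalgebra generated by all $T_i$ and $c_j$. For $\sigma\in S_n$ with reduced expression $\sigma=s_{i_1}\cdots s_{i_r}$ ($s_i=(i,i+1)$), $T_\sigma=T_{i_1}\cdots T_{i_r}$; for $I=\{i_1<\cdots<i_k\}\subseteq\{1,\ldots,n\}$, $C_I=c_{i_1}\cdots c_{i_k}$, $C_\emptyset=1$. The elements $T_\sigma C_I$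 form an $\mathbf{A}$-basis of $\mathcal{H}^c_{n,\mathbf{A}}$. For a composition $\gamma=(\gamma_1,\ldots,\gamma_\ell)$ of $n$ (positive parts) put $T_{\gamma,j}=T_{\gamma_1+\cdots+\gamma_{j-1}+1}T_{\gamma_1+\cdots+\gamma_{j-1}+2}\cdots T_{\gamma_1+\cdots+\gamma_j-1}$ (equal to $1$ if $\gamma_j=1$) and $T_{w_\gamma}=T_{\gamma,1}\cdots T_{\gamma,\ell}$. $\mathcal{OP}_n$ is the set of partitions of $n$ with all parts odd. For an $R$-superalgebra $\mathcal H$, $[\mathcal{H},\mathcal{H}]$ is the $R$-span of all ordinary commutators $hh'-h'h$ (not supercommutators), and the subscript $\bar0$ denotes the even part. *)

(* Defs.v *)
From HB Require Import structures.
From mathcomp Require Import all_boot all_order all_algebra all_fingroup.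
From mathcomp Require Import generic_quotient.
From mathcomp Require Import complex.
From mathcomp Require Import boolp reals.

Set Implicit Arguments.
Unset Strict Implicit.
Unset Printing Implicit Defensive.

Import GRing.Theory.
Local Open Scope ring_scope.
Local Open Scope quotient_scope.

(* Indices are 0-based: i : 'I_n.-1 stands for the index i+1 of T_{i+1} and
   s_{i+1} = (i+1, i+2), and j : 'I_n for the index j+1 of c_{j+1}; idx i and
   idxS i are the two points moved by s_{i+1}. *)
Lemma idx_subproof n (i : 'I_n.-1) : (i < n)%N.
Proof. exact: leq_trans (ltn_ord i) (leq_pred n). Qed.

Lemma idxS_subproof n (i : 'I_n.-1) : (i.+1 < n)%N.
Proof. by case: n i => [|n] i; [case: i | exact: ltn_ord]. Qed.

Definition idx n (i : 'I_n.-1) : 'I_n := Ordinal (idx_subproof i).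
Definition idxS n (i : 'I_n.-1) : 'I_n := Ordinal (idxS_subproof i).

Definition simple_refl n (i : 'I_n.-1) : 'S_n := tperm (idx i) (idxS i).

Definition word_perm n (w : seq 'I_n.-1) : 'S_n :=
  (\prod_(i <- w) simple_refl i)%g.

Definition reduced_expr n (s : 'S_n) (w : seq 'I_n.-1) : Prop :=
  word_perm w = s /\
  forall w' : seq 'I_n.-1, word_perm w' = s -> (size w <= size w')%N.

Lemma word_perm_cat n (w1 w2 : seq 'I_n.-1) :
  word_perm (w1 ++ w2) = (word_perm w1 * word_perm w2)%g.
Proof. exact: big_cat. Qed.

Lemma tperm_word n d (x y : 'I_n) : (y = x + d :> nat)%N ->
  exists w, word_perm w = tperm x y.
Proof.
elim: d x y => [|d IHd] x y Dy.
  exists [::]; rewrite /word_perm big_nil.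
  have ->: y = x by apply: val_inj; rewrite /= Dy addn0.
  by rewrite tperm1.
have lt_z : (x + d < n)%N by apply: leq_trans (ltn_ord y); rewrite Dy addnS.
pose z := Ordinal lt_z.
have lt_i : (x + d < n.-1)%N.
  by rewrite ltn_predRL -addnS -Dy ltn_ord.
pose i : 'I_n.-1 := Ordinal lt_i.
have Dz : idx i = z by apply: val_inj.
have Dy' : idxS i = y by apply: val_inj; rewrite /= Dy addnS.
have [w Dw] := IHd x z erefl.
have [d0 | d_gt0] := posnP d.
  exists [:: i]; rewrite /word_perm big_seq1 /simple_refl Dz Dy'.
  by have ->: z = x by apply: val_inj; rewrite /= d0 addn0.
exists ([:: i] ++ w ++ [:: i]).
rewrite !word_perm_cat Dw /word_perm !big_seq1 /simple_refl Dz Dy'.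
have nxz : x != z by rewrite -val_eqE /= neq_ltn -ltn_subLR ?subnn ?d_gt0.
have nxy : x != y by rewrite -val_eqE /= Dy neq_ltn addnS ltnS leq_addr.
have ->: tperm x y = (tperm x z ^ tperm z y)%g
  by rewrite tpermJ tpermL tpermD // eq_sym.
by rewrite conjgE tpermV mulgA.
Qed.

Lemma word_perm_surj n (s : 'S_n) : exists w, word_perm w = s.
Proof.
have tw (x y : 'I_n) : exists w, word_perm w = tperm x y.
  case/orP: (leq_total x y) => le_xy.
    by apply: (@tperm_word _ (y - x)); rewrite subnKC.
  rewrite tpermC.
  by apply: (@tperm_word _ (x - y)); rewrite subnKC.
have [ts -> _] := prod_tpermP s.
elim: ts => [|t ts [w Dw]]; first by exists [::]; rewrite /word_perm !big_nil.
have [w' Dw'] := tw t.1 t.2.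
by exists (w' ++ w); rewrite word_perm_cat Dw Dw' big_cons.
Qed.

Lemma reduced_expr_exists n (s : 'S_n) : exists w, reduced_expr s w.
Proof.
pose P k := `[< exists w : seq 'I_n.-1, word_perm w = s /\ size w = k >].
have exP : exists k, P k.
  by have [w Dw] := word_perm_surj s; exists (size w); apply/asboolP; exists w.
case: (ex_minnP exP) => k /asboolP[w [Dw <-]] min_w; exists w; split=> // w' Dw'.
by apply: min_w; apply/asboolP; exists w'.
Qed.

Definition reduced_word n (s : 'S_n) : seq 'I_n.-1 :=
  sval (cid (reduced_expr_exists s)).

Lemma reduced_wordP n (s : 'S_n) : reduced_expr s (reduced_word s).
Proof. exact: svalP (cid (reduced_expr_exists s)). Qed.

Section HeckeClifford.
Variables (K : fieldType) (v : K) (n : nat).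

Inductive hc_term : Type :=
| tT of 'I_n.-1
| tC of 'I_n
| tZero
| tOne
| tAdd of hc_term & hc_term
| tMul of hc_term & hc_term
| tScale of K & hc_term.

HB.instance Definition _ := gen_eqMixin hc_term.
HB.instance Definition _ := gen_choiceMixin hc_term.

(* The least K-algebra congruence on terms containing the defining relations;
   - x is (-1) *: x. *)
Inductive hc_equiv : hc_term -> hc_term -> Prop :=
| hc_refl x : hc_equiv x x
| hc_sym x y : hc_equiv x y -> hc_equiv y x
| hc_trans x y z : hc_equiv x y -> hc_equiv y z -> hc_equiv x z
| hc_congD x x' y y' :
    hc_equiv x x' -> hc_equiv y y' -> hc_equiv (tAdd x y) (tAdd x' y')
| hc_congM x x' y y' :
    hc_equiv x x' -> hc_equiv y y' -> hc_equiv (tMul x y) (tMul x' y')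
| hc_congZ a x x' : hc_equiv x x' -> hc_equiv (tScale a x) (tScale a x')
| hc_addA x y z : hc_equiv (tAdd x (tAdd y z)) (tAdd (tAdd x y) z)
| hc_addC x y : hc_equiv (tAdd x y) (tAdd y x)
| hc_add0 x : hc_equiv (tAdd tZero x) x
| hc_addN x : hc_equiv (tAdd (tScale (-1) x) x) tZero
| hc_mulA x y z : hc_equiv (tMul x (tMul y z)) (tMul (tMul x y) z)
| hc_mul1l x : hc_equiv (tMul tOne x) x
| hc_mul1r x : hc_equiv (tMul x tOne) x
| hc_mulDl x y z : hc_equiv (tMul (tAdd x y) z) (tAdd (tMul x z) (tMul y z))
| hc_mulDr x y z : hc_equiv (tMul x (tAdd y z)) (tAdd (tMul x y) (tMul x z))
| hc_scaleA a b x : hc_equiv (tScale a (tScale b x)) (tScale (a * b) x)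
| hc_scale1 x : hc_equiv (tScale 1 x) x
| hc_scaleDr a x y :
    hc_equiv (tScale a (tAdd x y)) (tAdd (tScale a x) (tScale a y))
| hc_scaleDl a b x :
    hc_equiv (tScale (a + b) x) (tAdd (tScale a x) (tScale b x))
| hc_scaleAl a x y : hc_equiv (tScale a (tMul x y)) (tMul (tScale a x) y)
| hc_scaleAr a x y : hc_equiv (tScale a (tMul x y)) (tMul x (tScale a y))
| hc_quad i :
    hc_equiv (tMul (tAdd (tT i) (tScale (- v) tOne)) (tAdd (tT i) tOne)) tZero
| hc_far (i j : 'I_n.-1) : (i.+1 < j)%N || (j.+1 < i)%N ->
    hc_equiv (tMul (tT i) (tT j)) (tMul (tT j) (tT i))
| hc_braid (i j : 'I_n.-1) : (j = i.+1 :> nat) ->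
    hc_equiv (tMul (tMul (tT i) (tT j)) (tT i))
             (tMul (tMul (tT j) (tT i)) (tT j))
| hc_csq j : hc_equiv (tMul (tC j) (tC j)) tOne
| hc_canti i j : i != j ->
    hc_equiv (tMul (tC i) (tC j)) (tScale (-1) (tMul (tC j) (tC i)))
| hc_Tc_far i j : j != idx i -> j != idxS i ->
    hc_equiv (tMul (tT i) (tC j)) (tMul (tC j) (tT i))
| hc_Tc i : hc_equiv (tMul (tT i) (tC (idx i))) (tMul (tC (idxS i)) (tT i)).

Definition hc_equivb (x y : hc_term) : bool := `[< hc_equiv x y >].

Lemma hc_equivb_refl : reflexive hc_equivb.
Proof. by move=> x; apply/asboolP; exact: hc_refl. Qed.

Lemma hc_equivb_sym : symmetric hc_equivb.
Proof. by move=> x y; apply/asboolP/asboolP; exact: hc_sym. Qed.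

Lemma hc_equivb_trans : transitive hc_equivb.
Proof.
by move=> y x z /asboolP xy /asboolP yz; apply/asboolP; exact: hc_trans xy yz.
Qed.

Canonical hc_equiv_rel :=
  EquivRel hc_equivb hc_equivb_refl hc_equivb_sym hc_equivb_trans.

Definition hecke_clifford : Type := {eq_quot hc_equiv_rel}.
HB.instance Definition _ := Choice.on hecke_clifford.
HB.instance Definition _ := Quotient.on hecke_clifford.

Local Notation H := hecke_clifford.
Local Notation cl x := (\pi_H x).

Lemma hc_eqP (x y : hc_term) : reflect (cl x = cl y) `[< hc_equiv x y >].
Proof. exact: eqmodP. Qed.

Lemma hc_eq (x y : hc_term) : hc_equiv x y -> cl x = cl y.
Proof. by move=> xy; apply/hc_eqP/asboolP. Qed.

Lemma hc_repr (x : hc_term) : hc_equiv (repr (cl x)) x.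
Proof. by apply/asboolP/hc_eqP; rewrite reprK. Qed.

Definition hc_zero : H := cl tZero.
Definition hc_one : H := cl tOne.
Definition hc_add : H -> H -> H := lift_op2 H tAdd.
Definition hc_opp : H -> H := lift_op1 H (tScale (-1)).
Definition hc_mul : H -> H -> H := lift_op2 H tMul.
Definition hc_scale (a : K) : H -> H := lift_op1 H (tScale a).

Lemma pi_hc_add x y : hc_add (cl x) (cl y) = cl (tAdd x y).
Proof.
by rewrite /hc_add; unlock; apply: hc_eq; apply: hc_congD; exact: hc_repr.
Qed.
Lemma pi_hc_opp x : hc_opp (cl x) = cl (tScale (-1) x).
Proof.
by rewrite /hc_opp; unlock; apply: hc_eq; apply: hc_congZ; exact: hc_repr.
Qed.
Lemma pi_hc_mul x y : hc_mul (cl x) (cl y) = cl (tMul x y).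
Proof.
by rewrite /hc_mul; unlock; apply: hc_eq; apply: hc_congM; exact: hc_repr.
Qed.
Lemma pi_hc_scale a x : hc_scale a (cl x) = cl (tScale a x).
Proof.
by rewrite /hc_scale; unlock; apply: hc_eq; apply: hc_congZ; exact: hc_repr.
Qed.

Definition pi_hcE := (pi_hc_add, pi_hc_opp, pi_hc_mul, pi_hc_scale).

Ltac hc_ax ax :=
  rewrite /hc_zero /hc_one !pi_hcE; apply: hc_eq; apply ax.

Fact hc_addrA : associative hc_add.
Proof.
by elim/quotW=> x; elim/quotW=> y; elim/quotW=> z; hc_ax hc_addA.
Qed.
Fact hc_addrC : commutative hc_add.
Proof. by elim/quotW=> x; elim/quotW=> y; hc_ax hc_addC. Qed.
Fact hc_add0r : left_id hc_zero hc_add.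
Proof. by elim/quotW=> x; hc_ax hc_add0. Qed.
Fact hc_addNr : left_inverse hc_zero hc_opp hc_add.
Proof. by elim/quotW=> x; hc_ax hc_addN. Qed.
Fact hc_mulrA : associative hc_mul.
Proof.
by elim/quotW=> x; elim/quotW=> y; elim/quotW=> z; hc_ax hc_mulA.
Qed.
Fact hc_mul1r_ : left_id hc_one hc_mul.
Proof. by elim/quotW=> x; hc_ax hc_mul1l. Qed.
Fact hc_mulr1_ : right_id hc_one hc_mul.
Proof. by elim/quotW=> x; hc_ax hc_mul1r. Qed.
Fact hc_mulrDl : left_distributive hc_mul hc_add.
Proof.
by elim/quotW=> x; elim/quotW=> y; elim/quotW=> z; hc_ax hc_mulDl.
Qed.
Fact hc_mulrDr : right_distributive hc_mul hc_add.
Proof.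
by elim/quotW=> x; elim/quotW=> y; elim/quotW=> z; hc_ax hc_mulDr.
Qed.

HB.instance Definition _ := GRing.isZmodule.Build H
  hc_addrA hc_addrC hc_add0r hc_addNr.
HB.instance Definition _ := GRing.Zmodule_isPzRing.Build H
  hc_mulrA hc_mul1r_ hc_mulr1_ hc_mulrDl hc_mulrDr.

Fact hc_scalerA a b x : hc_scale a (hc_scale b x) = hc_scale (a * b) x.
Proof. by elim/quotW: x => x; hc_ax hc_scaleA. Qed.
Fact hc_scale1r : left_id 1 hc_scale.
Proof. by elim/quotW=> x; hc_ax hc_scale1. Qed.
Fact hc_scalerDr : right_distributive hc_scale hc_add.
Proof. by move=> a; elim/quotW=> x; elim/quotW=> y; hc_ax hc_scaleDr. Qed.
Fact hc_scalerDl x : {morph hc_scale^~ x : a b / a + b >-> hc_add a b}.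
Proof. by move=> a b; elim/quotW: x => x; hc_ax hc_scaleDl. Qed.

HB.instance Definition _ := GRing.Zmodule_isLmodule.Build K H
  hc_scalerA hc_scale1r hc_scalerDr hc_scalerDl.

Lemma pi_hc_ops :
  (forall x y, cl (tAdd x y) = cl x + cl y) *
  (forall x y, cl (tMul x y) = cl x * cl y) *
  (forall a x, cl (tScale a x) = a *: cl x) *
  (cl tZero = 0) * (cl tOne = 1).
Proof.
by do !split=> *; rewrite -?pi_hc_add -?pi_hc_mul -?pi_hc_scale.
Qed.

Definition hcT (i : 'I_n.-1) : H := cl (tT i).
Definition hcC (j : 'I_n) : H := cl (tC j).

Lemma hc_scalerAl (a : K) (x y : H) : a *: (x * y) = (a *: x) * y.
Proof.
elim/quotW: x => x; elim/quotW: y => y; rewrite -!pi_hc_ops.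
by apply: hc_eq; apply: hc_scaleAl.
Qed.
Lemma hc_scalerAr (a : K) (x y : H) : a *: (x * y) = x * (a *: y).
Proof.
elim/quotW: x => x; elim/quotW: y => y; rewrite -!pi_hc_ops.
by apply: hc_eq; apply: hc_scaleAr.
Qed.

Lemma hcT_quad i : (hcT i - v *: (1 : H)) * (hcT i + 1) = 0.
Proof.
by rewrite -scaleNr -!pi_hc_ops; apply: hc_eq; apply: hc_quad.
Qed.
Lemma hcT_far (i j : 'I_n.-1) : (i.+1 < j)%N || (j.+1 < i)%N ->
  hcT i * hcT j = hcT j * hcT i.
Proof. by move=> ij; rewrite -!pi_hc_ops; apply: hc_eq; apply: hc_far. Qed.
Lemma hcT_braid (i j : 'I_n.-1) : (j = i.+1 :> nat) ->
  hcT i * hcT j * hcT i = hcT j * hcT i * hcT j.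
Proof. by move=> ij; rewrite -!pi_hc_ops; apply: hc_eq; apply: hc_braid. Qed.
Lemma hcC_sq j : hcC j * hcC j = 1.
Proof. by rewrite -!pi_hc_ops; apply: hc_eq; apply: hc_csq. Qed.
Lemma hcC_anti i j : i != j -> hcC i * hcC j = - (hcC j * hcC i).
Proof.
by move=> ij; rewrite -scaleN1r -!pi_hc_ops; apply: hc_eq; apply: hc_canti.
Qed.
Lemma hcT_C_far i j : j != idx i -> j != idxS i ->
  hcT i * hcC j = hcC j * hcT i.
Proof. by move=> ij iSj; rewrite -!pi_hc_ops; apply: hc_eq; apply: hc_Tc_far. Qed.
Lemma hcT_C i : hcT i * hcC (idx i) = hcC (idxS i) * hcT i.
Proof. by rewrite -!pi_hc_ops; apply: hc_eq; apply: hc_Tc. Qed.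

(* hc_homog b x: x is homogeneous of parity b (false = even, true = odd). *)
Inductive hc_homog : bool -> H -> Prop :=
| homogT i : hc_homog false (hcT i)
| homogC j : hc_homog true (hcC j)
| homog1 : hc_homog false 1
| homogD b x y : hc_homog b x -> hc_homog b y -> hc_homog b (x + y)
| homogZ b a x : hc_homog b x -> hc_homog b (a *: x)
| homogM b b' x y : hc_homog b x -> hc_homog b' y -> hc_homog (b (+) b') (x * y).

(* The A-subalgebra generated by the T_i and the c_j, for A a subring of K. *)
Inductive hc_subalg (A : K -> Prop) : H -> Prop :=
| subalgT i : hc_subalg A (hcT i)
| subalgC j : hc_subalg A (hcC j)
| subalg1 : hc_subalg A 1
| subalgD x y : hc_subalg A x -> hc_subalg A y -> hc_subalg A (x + y)
| subalgZ a x : A a -> hc_subalg A x -> hc_subalg A (a *: x)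
| subalgM x y : hc_subalg A x -> hc_subalg A y -> hc_subalg A (x * y).

Inductive comm_span (A : K -> Prop) (B : H -> Prop) : H -> Prop :=
| comm_span0 : comm_span A B 0
| comm_spanD a h h' z : A a -> B h -> B h' -> comm_span A B z ->
    comm_span A B (a *: (h * h' - h' * h) + z).

Definition comm_even (A : K -> Prop) (x : H) : Prop :=
  comm_span A (hc_subalg A) x /\ hc_homog false x.

(* T_sigma does not depend on the chosen reduced expression (Matsumoto). *)
Definition T_perm (s : 'S_n) : H := \prod_(i <- reduced_word s) hcT i.

(* enum lists I in increasing order. *)
Definition C_set (I : {set 'I_n}) : H := \prod_(j <- enum I) hcC j.

Definition hcT_nat (k : nat) : H := if insub k is Some i then hcT i else 1.

(* Block j of gamma starts at position m = gamma_1 + ... + gamma_{j-1}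
   (0-based) and contributes T_{m+1} ... T_{m+gamma_j-1} (1-based). *)
Definition T_block (gamma : seq nat) (j : nat) : H :=
  let m := sumn (take j gamma) in
  \prod_(m <= k < m + (nth 0%N gamma j).-1) hcT_nat k.

Definition T_comp (gamma : seq nat) : H :=
  \prod_(0 <= j < size gamma) T_block gamma j.

End HeckeClifford.

Definition is_odd_partition (n : nat) (s : seq nat) : bool :=
  [&& sorted geq s, all odd s & sumn s == n].

(* The bounds (at most n parts, each at most n) lose nothing: see odd_partP. *)
Definition parts n (nu : n.-bseq 'I_n.+1) : seq nat :=
  [seq nat_of_ord i | i <- nu].

Definition odd_part (n : nat) : {set n.-bseq 'I_n.+1} :=
  [set nu | is_odd_partition n (parts nu)].

Lemma parts_inj n : injective (@parts n).
Proof. by move=> s t /(inj_map val_inj)/val_inj. Qed.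

Lemma odd_partP n (s : seq nat) :
  reflect (exists2 nu, nu \in odd_part n & parts nu = s) (is_odd_partition n s).
Proof.
apply: (iffP idP) => [Ps | [nu + <-]]; last by rewrite inE.
have /and3P[_ odd_s /eqP sum_s] := Ps.
have sz_s : (size s <= n)%N.
  rewrite -sum_s; elim: s odd_s {Ps sum_s} => //= x s IHs /andP[odd_x odd_s].
  by rewrite -add1n leq_add ?IHs ?odd_gt0.
have le_s x : x \in s -> (x <= n)%N.
  move=> sx; rewrite -sum_s; elim: s sx {Ps odd_s sum_s sz_s} => //= y s IHs.
  rewrite inE => /predU1P[->|/IHs le_x]; first exact: leq_addr.
  exact: leq_trans le_x (leq_addl _ _).
have Ds : [seq nat_of_ord i | i <- [seq inord i : 'I_n.+1 | i <- s]] = s.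
  by rewrite -map_comp map_id_in // => x /le_s le_x /=; rewrite inordK.
have sz_t : (size [seq inord i : 'I_n.+1 | i <- s] <= n)%N by rewrite size_map.
by exists (Bseq sz_t); rewrite ?inE /parts /= Ds.
Qed.

Inductive subring_gen (K : nzRingType) (S : K -> Prop) : K -> Prop :=
| sgen_in x : S x -> subring_gen S x
| sgen1 : subring_gen S 1
| sgenB x y : subring_gen S x -> subring_gen S y -> subring_gen S (x - y)
| sgenM x y : subring_gen S x -> subring_gen S y -> subring_gen S (x * y).

(* C(v^{1/2}), with C = R[i] and the polynomial variable in the role of
   v^{1/2}. *)
Definition Cv (R : realType) : fieldType := {fraction {poly R[i]}}.
Definition sqrt_v (R : realType) : Cv R := @tofrac {poly R[i]} 'X.
Definition ind_v (R : realType) : Cv R := sqrt_v R ^+ 2.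

Definition ringA (R : realType) : Cv R -> Prop :=
  subring_gen (fun x => [\/ x = 2%:R^-1, x = ind_v R | x = (ind_v R)^-1]).

Arguments T_comp {K} v {n} gamma.
Arguments comm_even {K v n} A x.

(* Main.v *)
Require Import Defs.
From mathcomp Require Import all_boot all_order all_algebra all_fingroup reals.
From mathcomp Require Import complex zify.

(** Indices are 0-based: T i acts on the strands i and i+1, C j on the strand
    j.  Write H_m for the subalgebra on the strands 0, ..., m-1, with
    coefficients in A.  The theorem says that every even element of H_n is
    congruent, modulo commutators and A-combinations of the T_comp nu with nu
    an odd partition, to 0.  So fix a predicate red that holds for these
    commutators and these T_comp nu and is closed under A-combinations; it is
    to be shown that red holds on the even part of H_n (red_even).  Two
    elements whose difference satisfies red are called congruent below;
    x * y and y * x always are.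

    Reduction to products of cycles.  H_(m+1) is spanned by the elements x,
    x * C m and x * T (m-1) * y with x, y in H_m (strand_top_split); this is
    the Hecke algebra decomposition with a Clifford term added.  Let c be an
    ascending product T m ... T (q-1).  In x * T (m-1) * y * c the factor y
    commutes with c, so the element is congruent to (y * x) * T (m-1) * c: the
    cycle has grown by one strand.  In x * C m * c, if the total is even then x
    and C m * c are odd elements on disjoint strands; they anticommute, hence
    2 x (C m * c) is a commutator and this term vanishes as 1/2 is in A
    (red_odd_odd).  Only x * c is left, with x an even element of H_m.
    Iteration turns an even element into a combination of products of cycles
    on consecutive blocks of strands, without any C (red_strand_blocks).

    Cycles on an even number of strands.  Let w = T p ... T (q-1) with q - p
    odd.  The relation w * C i = C (i+1) * w for i < q makes w * C p * C q
    congruent to w (Tcycle_CC_chain).  Pushing C q leftwards through w gives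
    w * C q = C p * w + (terms with one T missing), so that
    w * C q * C p is congruent to w + (such terms).  As C p and C q
    anticommute, 2 w is congruent to terms with one T missing, that is, to
    products whose top cycle is shorter (red_even_cycle); induction on the
    length of the top cycle applies.

    Order of the blocks.  Let w be the cycle on the first a + b strands.  Then
    w * T i = T (i+1) * w and w^2 * T (a+b-2) = T 0 * w^2, so conjugation by
    w^b sends T i to T (i+b) for i+1 < a and T (a+i) to T i for i+1 < b: it
    exchanges two adjacent groups of blocks with a and b strands.  Since w is
    invertible over A, permuted compositions give congruent elements
    (red_blocks_perm), and an odd composition may be sorted into a partition. *)

Set Implicit Arguments.
Unset Strict Implicit.
Unset Printing Implicit Defensive.

Import GRing.Theory.
Local Open Scope ring_scope.

(** * Relations between the generators *)

Section TraceReduction.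

Variables (K : fieldType) (v : K) (n : nat).
Local Notation H := (hecke_clifford v n).
Local Notation T := (hcT_nat v n).

(** Indexing by natural numbers, as hcT_nat does, makes shifts of strands
    plain arithmetic; the price is a bound on the index in most relations. *)
Definition hcC_nat (k : nat) : H := if insub k is Some j then hcC v j else 1.
Local Notation C := hcC_nat.

Lemma hcT_natE (i : 'I_n.-1) : T i = hcT v i.
Proof. by rewrite /hcT_nat valK. Qed.

Lemma hcC_natE (j : 'I_n) : C j = hcC v j.
Proof. by rewrite /hcC_nat valK. Qed.

Lemma hcT_natP k : (k.+1 < n)%N -> exists i : 'I_n.-1, k = i.
Proof.
move=> k_lt; have k_lt' : (k < n.-1)%N by lia.
by exists (Ordinal k_lt').
Qed.

Lemma T_quad k : (k.+1 < n)%N -> T k * T k = (v - 1) *: T k + v *: (1 : H).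
Proof.
case/hcT_natP=> i ->; rewrite hcT_natE.
have /eqP := hcT_quad v i.
rewrite mulrDr mulr1 mulrBl -hc_scalerAl mul1r addr_eq0 => /eqP E.
rewrite -[LHS](subrK (v *: hcT v i)) E opprB scalerBl scale1r.
by rewrite addrC addrCA addrC.
Qed.

Lemma T_far i j : (i.+1 < j)%N -> T i * T j = T j * T i.
Proof.
move=> ij; rewrite /hcT_nat; case: insubP => [i' _ Di|_]; last first.
  by rewrite mul1r mulr1.
case: insubP => [j' _ Dj|_]; last by rewrite mul1r mulr1.
by apply: hcT_far; rewrite Di Dj ij.
Qed.

Lemma T_braid k : (k.+2 < n)%N -> T k * T k.+1 * T k = T k.+1 * T k * T k.+1.
Proof.
move=> k_lt; have [j Dj] := hcT_natP k_lt.
have [|i Di] := @hcT_natP k; first by lia.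
by rewrite Dj Di !hcT_natE hcT_braid // -Dj Di.
Qed.

Lemma C_sq k : C k * C k = 1.
Proof.
rewrite /hcC_nat; case: insubP => [j _ _|_]; first exact: hcC_sq.
exact: mul1r.
Qed.

Lemma C_anti i j : (i < n)%N -> (j < n)%N -> i != j -> C i * C j = - (C j * C i).
Proof.
move=> lt_i lt_j ij.
by rewrite (hcC_natE (Ordinal lt_i)) (hcC_natE (Ordinal lt_j)) hcC_anti.
Qed.

Lemma TC_far i j : j != i -> j != i.+1 -> T i * C j = C j * T i.
Proof.
move=> ij iSj; rewrite /hcT_nat /hcC_nat.
case: insubP => [i' _ Di|_]; last by rewrite mul1r mulr1.
case: insubP => [j' _ Dj|_]; last by rewrite mul1r mulr1.
by apply: hcT_C_far; rewrite -val_eqE /= Di Dj.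
Qed.

Lemma TC k : (k.+1 < n)%N -> T k * C k = C k.+1 * T k.
Proof.
case/hcT_natP=> i ->; rewrite hcT_natE.
by rewrite (hcC_natE (idx i)) (hcC_natE (idxS i)) hcT_C.
Qed.

Hypothesis v_neq0 : v != 0.

Definition Tinv k : H := v^-1 *: (T k - (v - 1) *: (1 : H)).

Lemma T_Tinv k : (k.+1 < n)%N -> T k * Tinv k = 1.
Proof.
move=> k_lt; rewrite -hc_scalerAr mulrBr T_quad // -hc_scalerAr mulr1.
by rewrite addrC addKr scalerA mulVf // scale1r.
Qed.

Lemma Tinv_T k : (k.+1 < n)%N -> Tinv k * T k = 1.
Proof.
move=> k_lt; rewrite -hc_scalerAl mulrBl T_quad // -hc_scalerAl mul1r.
by rewrite addrC addKr scalerA mulVf // scale1r.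
Qed.

(** The relation T C_k = C_(k+1) T, conjugated by T: multiply it by T on the
    left, use the quadratic relation for T T C_k, and cancel the T on the right
    of T C_(k+1) T. *)
Lemma TCS k : (k.+1 < n)%N ->
  T k * C k.+1 = C k * T k + (v - 1) *: (C k.+1 - C k).
Proof.
move=> k_lt; rewrite -[LHS]mulr1 -(T_Tinv k_lt) mulrA -[_ * _ * T k]mulrA -TC //.
rewrite mulrA T_quad // mulrDl -!hc_scalerAl mul1r TC // mulrDl -!hc_scalerAl.
rewrite -mulrA T_Tinv // mulr1 /Tinv -hc_scalerAr scalerA divff // scale1r.
by rewrite mulrBr -hc_scalerAr mulr1 scalerBr addrC addrA addrAC.
Qed.

(** * Subalgebras on an interval of strands *)

Variable A : K -> Prop.
Hypothesis A_1 : A 1.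
Hypothesis A_B : forall a b, A a -> A b -> A (a - b).
Hypothesis A_M : forall a b, A a -> A b -> A (a * b).
Hypothesis A_v : A v.

Lemma A_0 : A 0.
Proof. by rewrite -(subrr 1); apply: A_B. Qed.

Lemma A_N a : A a -> A (- a).
Proof. by move=> Aa; rewrite -sub0r; apply: A_B => //; apply: A_0. Qed.

Lemma A_v1 : A (v - 1).
Proof. exact: A_B. Qed.

(** The A-subalgebra on the strands lo, ..., hi - 1, split by parity: T i
    involves the strands i and i+1.  Tracking strands and parity together gives
    the sign rule for elements on disjoint strands. *)
Inductive strand (lo hi : nat) : bool -> H -> Prop :=
| strandT i : (lo <= i)%N -> (i.+1 < hi)%N -> strand lo hi false (T i)
| strandC j : (lo <= j < hi)%N -> strand lo hi true (C j)
| strand1 : strand lo hi false 1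
| strandD b x y : strand lo hi b x -> strand lo hi b y -> strand lo hi b (x + y)
| strandZ b a x : A a -> strand lo hi b x -> strand lo hi b (a *: x)
| strandM b b' x y : strand lo hi b x -> strand lo hi b' y ->
    strand lo hi (b (+) b') (x * y).

Lemma strandN lo hi b x : strand lo hi b x -> strand lo hi b (- x).
Proof. by rewrite -scaleN1r; apply: strandZ; apply: A_N. Qed.

Lemma strandB lo hi b x y :
  strand lo hi b x -> strand lo hi b y -> strand lo hi b (x - y).
Proof. by move=> Sx /strandN; apply: strandD. Qed.

Lemma strandMl lo hi b x y :
  strand lo hi false x -> strand lo hi b y -> strand lo hi b (x * y).
Proof. exact: strandM. Qed.

Lemma strandMr lo hi b x y :
  strand lo hi b x -> strand lo hi false y -> strand lo hi b (x * y).
Proof. by rewrite -{2}[b]addbF; apply: strandM. Qed.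

Lemma strandMoo lo hi x y :
  strand lo hi true x -> strand lo hi true y -> strand lo hi false (x * y).
Proof. exact: strandM. Qed.

Lemma strand_sub lo hi lo' hi' b x : (lo' <= lo)%N -> (hi <= hi')%N ->
  strand lo hi b x -> strand lo' hi' b x.
Proof.
move=> le_lo le_hi.
elim=> {b x} [i lei lti|j /andP[lej ltj]||b x y _ + _|b a x Aa _
               |b b' x y _ + _].
- by apply: strandT; lia.
- by apply: strandC; lia.
- exact: strand1.
- exact: strandD.
- exact: strandZ.
- exact: strandM.
Qed.

Lemma strand_subalg lo hi b x : (hi <= n)%N -> strand lo hi b x -> hc_subalg A x.
Proof.
move=> le_hi; elim=> {b x} [i lei lti|j /andP[lej ltj]||b x y _ + _|b a x Aa _
               |b b' x y _ + _].
- have [|k ->] := @hcT_natP i; first by lia.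
  by rewrite hcT_natE; apply: subalgT.
- have ltjn : (j < n)%N by lia.
  by rewrite (hcC_natE (Ordinal ltjn)); apply: subalgC.
- exact: subalg1.
- exact: subalgD.
- exact: subalgZ.
- exact: subalgM.
Qed.

Lemma strand_homog lo hi b x : (hi <= n)%N -> strand lo hi b x -> hc_homog b x.
Proof.
move=> le_hi; elim=> {b x} [i lei lti|j /andP[lej ltj]||b x y _ + _|b a x Aa _
               |b b' x y _ + _].
- have [|k ->] := @hcT_natP i; first by lia.
  by rewrite hcT_natE; apply: homogT.
- have ltjn : (j < n)%N by lia.
  by rewrite (hcC_natE (Ordinal ltjn)); apply: homogC.
- exact: homog1.
- exact: homogD.
- exact: homogZ.
- exact: homogM.
Qed.

(** Two applications, one to each factor, extend the sign rule from the
    generators to all elements on disjoint strands. *)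
Lemma supercomm_gen lo hi (b b' : bool) x y : strand lo hi b x ->
    (forall i, (lo <= i)%N -> (i.+1 < hi)%N -> T i * y = y * T i) ->
    (forall j, (lo <= j < hi)%N -> C j * y = (-1) ^+ b' *: (y * C j)) ->
  x * y = (-1) ^+ (b && b') *: (y * x).
Proof.
move=> Sx yT yC.
elim: Sx => {b x} [i lei lti|j ltj||b x z _ IHx _ IHz|b a x Aa _ IHx
                  |b c x z _ IHx _ IHz].
- by rewrite scale1r yT.
- by rewrite yC.
- by rewrite mul1r mulr1 scale1r.
- by rewrite mulrDl IHx IHz mulrDr scalerDr.
- by rewrite -hc_scalerAl IHx -hc_scalerAr !scalerA mulrC.
- rewrite -mulrA IHz -hc_scalerAr mulrA IHx -hc_scalerAl scalerA mulrA.
  by rewrite andb_addl signr_addb mulrC.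
Qed.

Lemma strand_supercomm lo mid mid' hi (b b' : bool) x y :
    (mid <= mid')%N -> (hi <= n)%N ->
    strand lo mid b x -> strand mid' hi b' y ->
  x * y = (-1) ^+ (b && b') *: (y * x).
Proof.
move=> le_mid le_hi Sx Sy.
have sg0 (z : H) : (-1) ^+ false *: z = z by rewrite scale1r.
apply: (supercomm_gen Sx) => [i lei lti|j /andP[lej ltj]].
  symmetry; rewrite -[RHS]sg0 -(andbF b').
  apply: (supercomm_gen Sy) => [k lek ltk|k /andP[lek ltk]].
    by rewrite [RHS]T_far //; lia.
  by rewrite sg0 TC_far //; lia.
have := @supercomm_gen mid' hi b' true y (C j) Sy; rewrite andbT => ->.
- by rewrite scalerA -signr_addb addbb scale1r.
- by move=> k lek ltk; rewrite TC_far //; lia.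
by move=> k /andP[lek ltk]; rewrite scaleN1r C_anti //; lia.
Qed.

Lemma strand_commute lo mid mid' hi b x y : (mid <= mid')%N -> (hi <= n)%N ->
    strand lo mid b x -> strand mid' hi false y ->
  x * y = y * x.
Proof.
by move=> le1 le2 Sx Sy; rewrite (strand_supercomm le1 le2 Sx Sy) andbF scale1r.
Qed.

Lemma strand_even_commute lo mid mid' hi b x y : (mid <= mid')%N -> (hi <= n)%N ->
    strand lo mid false x -> strand mid' hi b y ->
  x * y = y * x.
Proof.
by move=> le1 le2 Sx Sy; rewrite (strand_supercomm le1 le2 Sx Sy) scale1r.
Qed.

Lemma strand_anticomm lo mid mid' hi x y : (mid <= mid')%N -> (hi <= n)%N ->
    strand lo mid true x -> strand mid' hi true y ->
  x * y = - (y * x).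
Proof.
by move=> le1 le2 Sx Sy; rewrite (strand_supercomm le1 le2 Sx Sy) scaleN1r.
Qed.

Lemma A_sign (b : bool) : A ((-1) ^+ b).
Proof. by case: b => //=; apply: A_N. Qed.

Lemma C_strand m (b : bool) x : (m < n)%N -> strand 0 m b x ->
  C m * x = (-1) ^+ b *: (x * C m).
Proof.
move=> m_lt Sx; have SC : strand m m.+1 true (C m) by apply: strandC; lia.
rewrite (strand_supercomm _ _ Sx SC) // andbT scalerA -signr_addb addbb.
by rewrite scale1r.
Qed.

Lemma T_strand p b x : (p.+1 < n)%N -> strand 0 p b x -> T p * x = x * T p.
Proof.
move=> p_lt Sx; have ST : strand p p.+2 false (T p) by apply: strandT; lia.
by rewrite (strand_commute _ _ Sx ST).
Qed.

(** Normal form of an element of H_(m+1) relative to H_m: the top strand m is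
    reached by at most one of T (m-1) and C m, and at most once. *)
Inductive top_split (m : nat) : bool -> H -> Prop :=
| top_low b x : strand 0 m b x -> top_split m b x
| top_C b x : strand 0 m b x -> top_split m (~~ b) (x * C m)
| top_T p b b' x y : m = p.+1 -> strand 0 m b x -> strand 0 m b' y ->
    top_split m (b (+) b') (x * T p * y)
| top_D b x y : top_split m b x -> top_split m b y -> top_split m b (x + y).

Lemma top_Z m b a x : A a -> top_split m b x -> top_split m b (a *: x).
Proof.
move=> Aa; elim=> {b x} [b x Sx|b x Sx|p b b' x y Dm Sx Sy|b x y _ + _].
- by apply: top_low; apply: strandZ.
- by rewrite hc_scalerAl; apply: top_C; apply: strandZ.
- by rewrite !hc_scalerAl; apply: top_T => //; apply: strandZ.
- by rewrite scalerDr; apply: top_D.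
Qed.

Lemma top_Ml m b b' x y : strand 0 m b x -> top_split m b' y ->
  top_split m (b (+) b') (x * y).
Proof.
move=> Sx; elim=> {b' y} [c y Sy|c y Sy|p c c' y z Dm Sy Sz|c y z _ + _].
- by apply: top_low; apply: strandM.
- by rewrite mulrA addbN; apply: top_C; apply: strandM.
- by rewrite !mulrA addbA; apply: top_T => //; apply: strandM.
- by rewrite mulrDr; apply: top_D.
Qed.

Lemma top_B m b x y : top_split m b x -> top_split m b y -> top_split m b (x - y).
Proof.
by move=> Sx Sy; apply: top_D => //; rewrite -scaleN1r; apply: top_Z (A_N A_1) _.
Qed.

Lemma top_Mlow m b b' x y : (m < n)%N ->
  top_split m b x -> strand 0 m b' y -> top_split m (b (+) b') (x * y).
Proof.
move=> m_lt Sx Sy; elim: Sx => {b x} [b x Sx|b x Sx|p b c x z Dm Sx Sz|b x z _ + _].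
- by apply: top_low; apply: strandM.
- rewrite -mulrA (C_strand m_lt Sy) -hc_scalerAr mulrA addNb.
  by apply: top_Z (A_sign _) _; apply: top_C; apply: strandM.
- by rewrite -!mulrA mulrA -addbA; apply: top_T => //; apply: strandM.
- by rewrite mulrDl; apply: top_D.
Qed.

Lemma top_T1 p : top_split p.+1 false (T p).
Proof.
rewrite -[T p]mul1r -[_ * _]mulr1.
by apply: (top_T (erefl _) (strand1 _ _) (strand1 _ _)).
Qed.

Lemma top_C1 m : top_split m true (C m).
Proof. by rewrite -[C m]mul1r; apply: (top_C (strand1 _ _)). Qed.

Lemma top_CT p : (p.+1 < n)%N -> top_split p.+1 true (C p.+1 * T p).
Proof.
move=> p_lt; rewrite -TC //; apply: top_Mlow (top_T1 p) _ => //.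
by apply: strandC; lia.
Qed.

Lemma top_TC p : (p.+1 < n)%N -> top_split p.+1 true (T p * C p.+1).
Proof.
move=> p_lt; have Cp : strand 0 p.+1 true (C p) by apply: strandC; lia.
rewrite TCS //; apply: top_D; first exact: (top_Ml Cp (top_T1 p)).
by apply: top_Z (A_v1) _; apply: top_B (top_C1 _) (top_low Cp).
Qed.

Lemma top_MC m b x : (m < n)%N -> top_split m b x -> top_split m (~~ b) (x * C m).
Proof.
move=> m_lt; elim=> {b x} [b x Sx|b x Sx|p b c x z Dm Sx Sz|b x z _ + _].
- exact: top_C.
- by rewrite -mulrA C_sq mulr1 negbK; apply: top_low.
- move: m_lt Sx Sz; rewrite {}Dm => m_lt Sx Sz.
  have -> : x * T p * z * C p.+1 = (-1) ^+ c *: (x * (T p * C p.+1) * z).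
    rewrite -mulrA -!mulrA (C_strand m_lt Sz) -!hc_scalerAr scalerA.
    by rewrite -signr_addb addbb scale1r.
  have -> : ~~ (b (+) c) = b (+) true (+) c by rewrite addbT addNb.
  apply: top_Z (A_sign _) _; apply: top_Mlow => //.
  by apply: top_Ml => //; apply: top_TC.
- by rewrite mulrDl; apply: top_D.
Qed.

(** The one product that recreates two top generators.  If z avoids the strand
    p, the two T p meet and the quadratic relation applies.  If z = x * C p,
    then C p is carried over the second T p, where it becomes C (p+1) up to
    terms with one T p less.  If z
    contains T (p-1), the braid relation leaves a single T p. *)
Lemma top_TxT p b z : (p.+1 < n)%N -> top_split p b z ->
  top_split p.+1 b (T p * z * T p).
Proof.
move=> p_lt.
have sub c x : strand 0 p c x -> strand 0 p.+1 c x by apply: strand_sub; lia.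
have TT : top_split p.+1 false (T p * T p).
  rewrite T_quad //; apply: top_D; apply: top_Z => //; first exact: A_v1.
    exact: top_T1.
  by apply: top_low; apply: strand1.
elim=> {b z} [b x Sx|b x Sx|q b c x z Dm Sx Sz|b x z _ + _].
- rewrite (T_strand p_lt Sx) -mulrA -[b]addbF.
  by apply: top_Ml TT; apply: sub.
- have Cp : strand 0 p.+1 true (C p) by apply: strandC; lia.
  have -> : T p * (x * C p) * T p =
      x * (T p * T p * C p.+1 - (v - 1) *: (T p * C p.+1 - T p * C p)).
    rewrite mulrA (T_strand p_lt Sx) -!mulrA; congr (x * _).
    by rewrite -mulrBr hc_scalerAr -mulrBr TCS // addrK.
  rewrite -addbT; apply: top_Ml; first exact: sub.
  apply: top_B; first by have := top_MC p_lt TT.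
  apply: top_Z (A_v1) _; apply: top_B (top_TC p_lt) _.
  by apply: top_Mlow (top_T1 p) _.
- have lt_q : (q.+2 < n)%N by lia.
  have Tq : strand 0 p.+1 false (T q) by apply: strandT; lia.
  have -> : T p * (x * T q * z) * T p = (x * T q) * T p * (T q * z).
    rewrite !mulrA -(mulrA _ z) -(T_strand p_lt Sz) !mulrA (T_strand p_lt Sx).
    by rewrite -!mulrA; congr (x * _); rewrite !mulrA Dm T_braid.
  apply: top_T => //.
    by apply: strandMr => //; apply: sub.
  by apply: strandMl => //; apply: sub.
- by rewrite mulrDr mulrDl; apply: top_D.
Qed.

Lemma top_MT p b x : (p.+1 < n)%N ->
    (forall c z, strand 0 p.+1 c z -> top_split p c z) ->
  top_split p.+1 b x -> top_split p.+1 b (x * T p).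
Proof.
move=> p_lt IH; elim=> {b x} [b x Sx|b x Sx|q b c x z [<-] Sx Sz|b x z _ + _].
- by rewrite -[b]addbF; apply: top_Ml (top_T1 p).
- by rewrite -mulrA -addbT; apply: top_Ml (top_CT p_lt).
- rewrite -!mulrA [T p * _]mulrA.
  by apply: top_Ml => //; apply: top_TxT => //; apply: IH.
- by rewrite mulrDl; apply: top_D.
Qed.

(** The normal forms are stable under right multiplication by each generator;
    for T (m-1) this uses the normal form in H_m of the element that stands
    between the two copies of T (m-1). *)
Lemma strand_top_split m b x : (m < n)%N -> strand 0 m.+1 b x -> top_split m b x.
Proof.
elim/ltn_ind: m b x => m IHm b x m_lt Sx.
suff mulR c y : top_split m c y -> top_split m (c (+) b) (y * x).
  by rewrite -[x]mul1r -[b]addFb; apply/mulR/top_low/strand1.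
elim: Sx c y => {b x} [i _ lti|j /andP[_ ltj]||b x z _ IHx _ IHz
                      |b a x Aa _ IHx|b b' x z _ IHx _ IHz] c y Sy.
- have [lt_i | ge_i] := ltnP i.+1 m.
    by apply: top_Mlow => //; apply: strandT.
  have Dm : m = i.+1 by lia.
  move: m_lt IHm Sy; rewrite {}Dm addbF => m_lt IHm Sy.
  by apply: top_MT => // d z; apply: IHm => //; lia.
- have [lt_j | ge_j] := ltnP j m.
    by apply: top_Mlow => //; apply: strandC.
  have -> : j = m by lia.
  by rewrite addbT; apply: top_MC.
- by rewrite mulr1 addbF.
- by rewrite mulrDr; apply: top_D; auto.
- by rewrite -hc_scalerAr; apply: top_Z; auto.
- by rewrite mulrA addbA; auto.
Qed.

(** * Cycles *)

(** The standard Coxeter element of the strands p, ..., q. *)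
Definition Tcycle (p q : nat) : H := \prod_(p <= k < q) T k.

Lemma Tcycle_id p : Tcycle p p = 1.
Proof. by rewrite /Tcycle big_geq. Qed.

Lemma Tcycle_cat p j q : (p <= j <= q)%N -> Tcycle p q = Tcycle p j * Tcycle j q.
Proof. by case/andP=> pj jq; rewrite /Tcycle (big_cat_nat pj jq). Qed.

Lemma Tcycle_recl p q : (p < q)%N -> Tcycle p q = T p * Tcycle p.+1 q.
Proof. by move=> pq; rewrite /Tcycle big_ltn. Qed.

Lemma Tcycle_recr p q : (p <= q)%N -> Tcycle p q.+1 = Tcycle p q * T q.
Proof. by move=> pq; rewrite /Tcycle big_nat_recr. Qed.

Lemma strand_Tcycle lo hi p q : (lo <= p)%N -> (q < hi)%N || (q <= p)%N ->
  strand lo hi false (Tcycle p q).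
Proof.
move=> lo_p q_hi; rewrite /Tcycle big_seq_cond.
apply: (big_ind (strand lo hi false)); first exact: strand1.
  by move=> x y; apply: strandM.
by move=> k; rewrite mem_index_iota => H; apply: strandT; lia.
Qed.

Lemma Tcycle_C p q i : (p <= i < q)%N -> (q < n)%N ->
  Tcycle p q * C i = C i.+1 * Tcycle p q.
Proof.
case/andP=> pi iq q_lt; have iq' : (i <= q)%N by lia.
have SL : strand 0 i.+1 false (Tcycle p i) by apply: strand_Tcycle; lia.
have SR : strand i.+1 n false (Tcycle i.+1 q) by apply: strand_Tcycle; lia.
have SC : strand 0 i.+1 true (C i) by apply: strandC; lia.
have SC' : strand i.+1 n true (C i.+1) by apply: strandC; lia.
rewrite (@Tcycle_cat p i q) ?pi // (Tcycle_recl iq) -!mulrA.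
rewrite -(strand_commute _ _ SC SR) // (mulrA (T i)) TC //; last by lia.
by rewrite !mulrA (strand_even_commute _ _ SL SC').
Qed.

Lemma Tcycle_T p q i : (p <= i)%N -> (i.+1 < q)%N -> (q < n)%N ->
  Tcycle p q * T i = T i.+1 * Tcycle p q.
Proof.
move=> pi iq q_lt; have iq' : (i < q)%N by lia.
have SL : strand 0 i.+1 false (Tcycle p i) by apply: strand_Tcycle; lia.
have SR : strand i.+2 n false (Tcycle i.+2 q) by apply: strand_Tcycle; lia.
have ST : strand 0 i.+2 false (T i) by apply: strandT; lia.
have ST' : strand i.+1 n false (T i.+1) by apply: strandT; lia.
rewrite (@Tcycle_cat p i q) ?pi ?(ltnW iq') // (Tcycle_recl iq') (Tcycle_recl iq).
rewrite -!mulrA -(strand_commute _ _ ST SR) // !mulrA.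
rewrite -(strand_commute _ _ SL ST') // -!mulrA; congr (_ * _).
by rewrite !mulrA T_braid //; lia.
Qed.

(** What replaces the shift T i |-> T (i+1) at the end of the cycle.  With
    u = T p ... T (q-1), u' = T (p+1) ... T q and w = T p * u' = u * T q, the
    shift gives w * u = u' * w, hence w * w * T q = T p * u' * w * T q
    = T p * w * u * T q = T p * w * w. *)
Lemma Tcycle_sqr_T p q : (p <= q)%N -> (q.+1 < n)%N ->
  Tcycle p q.+1 ^+ 2 * T q = T p * Tcycle p q.+1 ^+ 2.
Proof.
move=> pq q_lt; rewrite expr2; set w := Tcycle p q.+1.
have wE : w = Tcycle p q * T q by exact: Tcycle_recr.
have wE' : w = T p * Tcycle p.+1 q.+1 by apply: Tcycle_recl; lia.
have shift : w * Tcycle p q = Tcycle p.+1 q.+1 * w.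
  rewrite /Tcycle big_add1 /= !big_nat.
  elim/big_rec2: _ => [|k x y].
    by rewrite mulr1 mul1r.
  by case/andP=> pk kq IH; rewrite mulrA Tcycle_T // -mulrA IH mulrA.
by rewrite {1}wE' -(mulrA (T p)) -shift -!mulrA -wE.
Qed.

(** * Products of cycles on consecutive blocks *)

(** T_comp s, moved to the strands from o on. *)
Fixpoint blocks (o : nat) (s : seq nat) : H :=
  if s is k :: s' then Tcycle o (o + k.-1) * blocks (o + k) s' else 1.

Lemma T_comp_blocks s : T_comp v s = blocks 0 s.
Proof.
suff gen o : \prod_(0 <= j < size s)
    Tcycle (o + sumn (take j s)) (o + sumn (take j s) + (nth 0%N s j).-1) =
  blocks o s by exact: (gen 0%N).
elim: s o => [|k s IHs] o /=; first by rewrite big_geq.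
rewrite big_nat_recl //= addn0 -IHs; congr (_ * _).
by apply: eq_bigr => j _; rewrite addnA.
Qed.

Lemma blocks_cat o s1 s2 :
  blocks o (s1 ++ s2) = blocks o s1 * blocks (o + sumn s1) s2.
Proof.
elim: s1 o => [|k s1 IHs] o /=; first by rewrite mul1r addn0.
by rewrite IHs mulrA addnA.
Qed.

Lemma strand_blocks lo hi o s : (lo <= o)%N -> (o + sumn s <= hi)%N ->
  strand lo hi false (blocks o s).
Proof.
elim: s o => [|k s IHs] o /= lo_o s_hi; first exact: strand1.
by apply: strandMl; [apply: strand_Tcycle | apply: IHs]; lia.
Qed.

Lemma blocks_conj x o o' s :
    (forall i, (i.+1 < sumn s)%N -> x * T (o + i) = T (o' + i) * x) ->
  x * blocks o s = blocks o' s * x.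
Proof.
elim: s o o' => [|k s IHs] o o' /= xT; first by rewrite mulr1 mul1r.
have xc : x * Tcycle o (o + k.-1) = Tcycle o' (o' + k.-1) * x.
  rewrite /Tcycle -[in LHS](add0n o) -[in RHS](add0n o').
  rewrite ![(_ + k.-1)%N]addnC !big_addn !addnK !big_nat.
  elim/big_rec2: _ => [|i y z /andP[_ i_lt] IH]; first by rewrite mulr1 mul1r.
  by rewrite mulrA addnC xT ?[(o' + _)%N]addnC -?mulrA ?IH ?mulrA //; lia.
rewrite mulrA xc -!mulrA; congr (_ * _); apply: IHs => i i_lt.
by rewrite -!addnA xT //; lia.
Qed.

(** * Conjugation by invertible elements *)

Hypothesis A_vinv : A v^-1.

(** The inverse has to lie over A as well: only commutators of elements of the
    A-form are available. *)
Definition subalg_unit (x : H) : Prop :=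
  hc_subalg A x /\ exists y, [/\ hc_subalg A y, x * y = 1 & y * x = 1].

Lemma subalg_unitM x y : subalg_unit x -> subalg_unit y -> subalg_unit (x * y).
Proof.
move=> [Ax [x' [Ax' xx' x'x]]] [Ay [y' [Ay' yy' y'y]]]; split.
  exact: subalgM.
exists (y' * x'); split; first exact: subalgM.
  by rewrite mulrA -(mulrA x) yy' mulr1.
by rewrite mulrA -(mulrA y') x'x mulr1.
Qed.

Lemma subalg_unit1 : subalg_unit 1.
Proof.
by split; last (exists 1; rewrite mulr1; split=> //); apply: subalg1.
Qed.

Lemma subalg_unitT k : (k.+1 < n)%N -> subalg_unit (T k).
Proof.
move=> k_lt; have AT : hc_subalg A (T k).
  have ST : strand 0 n false (T k) by apply: strandT.
  exact: strand_subalg ST.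
split=> //; exists (Tinv k); split; [|exact: T_Tinv|exact: Tinv_T].
apply: subalgZ => //; apply: subalgD => //; rewrite -scaleNr.
by apply: subalgZ (A_N A_v1) _; apply: subalg1.
Qed.

Lemma subalg_unit_Tcycle p q : (q < n)%N || (q <= p)%N -> subalg_unit (Tcycle p q).
Proof.
move=> q_lt; rewrite /Tcycle big_seq_cond.
apply: (big_ind subalg_unit); [exact: subalg_unit1|exact: subalg_unitM|].
by move=> k; rewrite mem_index_iota => k_in; apply: subalg_unitT; lia.
Qed.

Lemma subalg_unitX x d : subalg_unit x -> subalg_unit (x ^+ d).
Proof.
move=> Ux; elim: d => [|d IHd]; first exact: subalg_unit1.
by rewrite exprS; apply: subalg_unitM.
Qed.

Lemma TcycleX_T q d i : (i + d < q)%N -> (q < n)%N ->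
  Tcycle 0 q ^+ d * T i = T (i + d) * Tcycle 0 q ^+ d.
Proof.
move=> i_lt q_lt; elim: d => [|d IHd] in i_lt *.
  by rewrite addn0 mulr1 mul1r.
rewrite exprS -mulrA IHd; last by lia.
by rewrite mulrA Tcycle_T ?addnS -?mulrA //; lia.
Qed.

(** T (a+i) is shifted b - i - 2 times to the end of the cycle, jumps to T 0 by
    two further turns, and is then shifted i times: b turns in all. *)
Lemma TcycleX_swap a b i : (i.+1 < b)%N -> (a + b <= n)%N ->
  Tcycle 0 (a + b).-1 ^+ b * T (a + i) = T i * Tcycle 0 (a + b).-1 ^+ b.
Proof.
move=> i_lt ab_le; set q := (a + b).-1.
have qE : q = (a + b).-2.+1 by lia.
have bE : b = (i + (2 + (b - i.+2)))%N by lia.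
rewrite [in RHS]bE [X in _ ^+ X]bE !exprD -mulrA.
rewrite -(mulrA (_ ^+ 2)) TcycleX_T; [|lia..].
have -> : (a + i + (b - i.+2))%N = (a + b).-2 by lia.
rewrite (mulrA (_ ^+ 2)) qE Tcycle_sqr_T; [|lia..].
by rewrite -qE !mulrA TcycleX_T //; lia.
Qed.

(** * Congruence modulo commutators and odd partitions *)

Section Membership.

(** Quantifying over a predicate, instead of carrying coefficients, lets the
    whole reduction ignore which combination of the T_comp nu arises. *)
Variable red : H -> Prop.
Hypothesis red_D : forall x y, red x -> red y -> red (x + y).
Hypothesis red_Z : forall a x, A a -> red x -> red (a *: x).
Hypothesis red_comm : forall x y,
  hc_subalg A x -> hc_subalg A y -> red (x * y - y * x).

Lemma red_N x : red x -> red (- x).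
Proof. by rewrite -scaleN1r; apply: red_Z; apply: A_N. Qed.

Lemma red_cycle x y : hc_subalg A x -> hc_subalg A y -> red (x * y) -> red (y * x).
Proof.
move=> Ax Ay red_xy; rewrite -(subrK (x * y) (y * x)).
by apply: red_D red_xy; apply: red_comm.
Qed.

Lemma red_conj u x y :
  subalg_unit u -> hc_subalg A y -> u * x = y * u -> red x -> red y.
Proof.
move=> [Au [u' [Au' uu' u'u]]] Ay ux Gx.
rewrite -[y]mulr1 -uu' mulrA; apply: red_cycle => //; first exact: subalgM.
by rewrite -ux mulrA u'u mul1r.
Qed.

(** Any permutation is a composite of exchanges of two initial segments, and
    such an exchange is conjugation by a power of the cycle on the strands of
    these segments; the remaining blocks commute with it. *)
Lemma red_blocks_perm s t : perm_eq s t ->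
  sumn s = n /\ red (blocks 0 s) -> sumn t = n /\ red (blocks 0 t).
Proof.
apply: (catCA_perm_ind (P := fun s => sumn s = n /\ red (blocks 0 s))).
move=> s1 s2 s3 [sum_s Gs]; rewrite !sumn_cat in sum_s.
split; first by rewrite !sumn_cat addnCA.
have [le1 le2] : (sumn s1 <= n)%N /\ (sumn s2 <= n)%N by lia.
set a := sumn s1 in sum_s le1; set b := sumn s2 in sum_s le2.
pose u := Tcycle 0 (a + b).-1 ^+ b.
have Uu : subalg_unit u.
  by apply: subalg_unitX; apply: subalg_unit_Tcycle; lia.
apply: (red_conj Uu _ _ Gs).
  apply: (@strand_subalg 0 n false) => //.
  by apply: strand_blocks; rewrite ?sumn_cat; lia.
rewrite !blocks_cat !add0n -/a -/b mulrA.
have Eu1 : u * blocks 0 s1 = blocks b s1 * u.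
  apply: blocks_conj => i i_lt; rewrite add0n addnC TcycleX_T //; lia.
have Eu2 : u * blocks a s2 = blocks 0 s2 * u.
  apply: blocks_conj => i i_lt; rewrite add0n TcycleX_swap //; lia.
have B1 : strand b n false (blocks b s1) by apply: strand_blocks; lia.
have B2 : strand 0 b false (blocks 0 s2) by apply: strand_blocks.
have B3 : strand (a + b) n false (blocks (a + b) s3) by apply: strand_blocks; lia.
have Su : strand 0 (a + b) false u.
  rewrite /u; elim: (X in _ ^+ X) => [|d IHd]; first exact: strand1.
  by rewrite exprS; apply: strandMl => //; apply: strand_Tcycle; lia.
rewrite Eu1 -mulrA (mulrA u) Eu2 -mulrA (strand_commute _ _ Su B3) //.
by rewrite !mulrA (strand_commute _ _ B2 B1) // addnC.
Qed.

Hypothesis A_half : A 2%:R^-1.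
Hypothesis two_neq0 : 2%:R != 0 :> K.
Hypothesis red_odd_partition : forall s, is_odd_partition n s -> red (T_comp v s).

Lemma red_0 : red 0.
Proof. by rewrite -(subrr (1 * 1)); apply: red_comm; apply: subalg1. Qed.

Lemma red_B x y : red x -> red y -> red (x - y).
Proof. by move=> Gx Gy; apply/red_D/red_N. Qed.

Lemma red_half x : red (x + x) -> red x.
Proof.
move=> G2x; rewrite -(scale1r x) -(mulVf two_neq0) -scalerA.
by apply: red_Z => //; rewrite scaler_nat mulr2n.
Qed.

Lemma red_odd_composition s : all odd s -> sumn s = n -> red (blocks 0 s).
Proof.
move=> odd_s sum_s; have ps : perm_eq (sort geq s) s by apply/permPl/perm_sort.
have Ps : is_odd_partition n (sort geq s).
  apply/and3P; split; last by rewrite (perm_sumn ps) sum_s.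
    by apply: sort_sorted => x y; apply: leq_total.
  by rewrite (perm_all _ ps).
by apply: (red_blocks_perm ps _).2; rewrite -T_comp_blocks (perm_sumn ps); auto.
Qed.

(** For anticommuting x and y, 2 x y = x y - y x is a commutator.  This is why
    no Clifford generator survives in the reduced form. *)
Lemma red_odd_odd m x y : (m <= n)%N ->
  strand 0 m true x -> strand m n true y -> red (x * y).
Proof.
move=> m_le Sx Sy; apply: red_half.
rewrite -{2}[x * y]opprK -mulNr.
have -> : - x * y = y * x.
  by rewrite mulNr (strand_anticomm _ _ Sx Sy) // opprK.
by apply: red_comm; [apply: strand_subalg Sx | apply: strand_subalg Sy].
Qed.

(** * Cycles on an even number of strands *)

(** Cyclically, w C_i C_q becomes C_q w C_i = C_q C_(i+1) w, and then
    w C_q C_(i+1), which is - w C_(i+1) C_q, or w if i + 1 = q.  The central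
    factor z stands for what happens on the other strands. *)
Lemma Tcycle_CC_chain p q i d z : (q < n)%N -> (p <= i)%N -> q = (i.+1 + d)%N ->
    hc_subalg A z -> (forall j, (p <= j <= q)%N -> C j * z = z * C j) ->
  red (Tcycle p q * C i * C q * z - (-1) ^+ d *: (Tcycle p q * z)).
Proof.
move=> q_lt pi Dq Az Cz; set w := Tcycle p q.
have AC j : (j <= q)%N -> hc_subalg A (C j).
  move=> jq; have SC : strand 0 n true (C j) by apply: strandC; lia.
  exact: strand_subalg SC.
have Aw : hc_subalg A w.
  have Sw : strand 0 n false w by apply: strand_Tcycle; lia.
  exact: strand_subalg Sw.
have step j : (p <= j < q)%N -> red (w * C j * C q * z - w * C q * C j.+1 * z).
  move=> j_in; have [Cjz CSz Cqz] : [/\ C j * z = z * C j,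
      C j.+1 * z = z * C j.+1 & C q * z = z * C q] by split; apply: Cz; lia.
  have -> : w * C j * C q * z = w * C j * z * C q by rewrite -!mulrA Cqz.
  have -> : w * C q * C j.+1 * z = w * z * (C q * C j.+1).
    by rewrite -!mulrA CSz (mulrA (C q)) Cqz !mulrA.
  rewrite -[X in red (X - _)](subrK (C q * (w * C j * z))) -addrA.
  apply: red_D.
    by apply: red_comm; do ?apply: subalgM => //; apply: AC; lia.
  rewrite Tcycle_C // -/w -(mulrA (C j.+1)) mulrA.
  by apply: red_comm; do ?apply: subalgM => //; apply: AC; lia.
elim: d i pi Dq => [|d IHd] i pi Dq.
  have Dq' : q = i.+1 by lia.
  have Gi : red (w * C i * C q * z - w * C q * C i.+1 * z) by apply: step; lia.
  by move: Gi; rewrite -Dq' -(mulrA w (C q)) C_sq mulr1 scale1r.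
have Gi : red (w * C i * C q * z - w * C q * C i.+1 * z) by apply: step; lia.
have GS : red (w * C i.+1 * C q * z - (-1) ^+ d *: (w * z)) by apply: IHd; lia.
have CC : C q * C i.+1 = - (C i.+1 * C q) by apply: C_anti; lia.
move: (red_B Gi GS); rewrite -(mulrA w (C q)) CC mulrN mulNr mulrA opprK.
by rewrite opprB addrA addrAC addrK exprS mulN1r scaleNr opprK.
Qed.

(** Both w C_p C_q and its negative w C_q C_p are congruent to w, up to terms
    where T j is missing for some j; these fall under red_odd_odd or, their top
    cycle being shorter, under the last hypothesis.  The terms appear one at a time when C_q is moved leftwards
    through w: F j has the Clifford generator in front of T j. *)
Lemma red_even_cycle p q x y : (q < n)%N -> (p <= q)%N -> odd (q - p) ->
    strand 0 p false x -> strand q.+1 n false y ->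
    (forall j u, (p < j <= q)%N -> strand 0 j false u ->
       red (u * Tcycle j q * y)) ->
  red (x * Tcycle p q * y).
Proof.
move=> q_lt le_pq odd_pq Sx Sy IH; have pq : (p < q)%N by lia.
pose w := Tcycle p q; pose z := x * y.
have Sw : strand p q.+1 false w by apply: strand_Tcycle; lia.
have -> : x * Tcycle p q * y = w * z.
  by rewrite (strand_commute _ _ Sx Sw) // mulrA.
have Sz : strand 0 n false z.
  by apply: strandMl; [apply: strand_sub Sx | apply: strand_sub Sy]; lia.
have Az : hc_subalg A z by apply: strand_subalg Sz.
have Cz j : (p <= j <= q)%N -> C j * z = z * C j.
  move=> j_in; have SC : strand p q.+1 true (C j) by apply: strandC; lia.
  rewrite mulrA -(strand_even_commute _ _ Sx SC) //.
  by rewrite -!mulrA (strand_commute _ _ SC Sy).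
have SCp : strand 0 p.+1 true (C p) by apply: strandC; lia.
have Sx' : strand 0 p.+1 false x by apply: strand_sub Sx; lia.
pose F j := Tcycle p j * C j * Tcycle j q * C p * z.
have step j : (p <= j < q)%N -> red (F j.+1 - F j).
  case/andP=> pj jq; pose l := Tcycle p j; pose r := Tcycle j.+1 q.
  have Sl : strand 0 j.+1 false l by apply: strand_Tcycle; lia.
  have Sr : strand j.+1 n false r by apply: strand_Tcycle; lia.
  have SCj : strand 0 j.+1 true (C j) by apply: strandC; lia.
  have SCS : strand j.+1 n true (C j.+1) by apply: strandC; lia.
  have SCx : strand 0 j.+1 true (C p * x).
    by apply: (@strand_sub 0 p.+1) => //; apply: strandMr.
  have Sy' : strand j.+1 n false y by apply: strand_sub Sy; lia.
  have -> : F j.+1 - F j =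
      (v - 1) *: (l * C j.+1 * r * C p * z - l * C j * r * C p * z).
    have E : l * T j * C j.+1 * r - l * C j * (T j * r) =
        (v - 1) *: (l * C j.+1 * r - l * C j * r).
      rewrite -(mulrA l) TCS; last by lia.
      rewrite mulrDr mulrDl !mulrA addrAC subrr add0r.
      by rewrite -hc_scalerAr -hc_scalerAl mulrBr mulrBl.
    rewrite /F (Tcycle_recr pj) (Tcycle_recl jq) -/l -/r -!mulrBl E.
    by rewrite -!hc_scalerAl !mulrBl.
  (* In the first of the two terms the cycle is cut between two odd elements
     on disjoint strands; in the second, C j and C p are both below the cut. *)
  apply: red_Z A_v1 _; apply: red_B.
    have -> : l * C j.+1 * r * C p * z = - ((l * (C p * x)) * (C j.+1 * r * y)).
      have SCr : strand j.+1 n true (C j.+1 * r) by apply: strandMr.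
      have := strand_anticomm (leqnn _) (leqnn _) SCx SCr.
      move/(congr1 -%R); rewrite opprK => E.
      transitivity (l * (C j.+1 * r * (C p * x)) * y); first by rewrite /z !mulrA.
      by rewrite -E mulrN mulNr !mulrA.
    apply: red_N; apply: (@red_odd_odd j.+1); first by lia.
      exact: strandMl.
    by do 2?apply: strandMr.
  have -> : l * C j * r * C p * z = (l * C j * (C p * x)) * r * y.
    transitivity (l * C j * (r * (C p * x)) * y); first by rewrite /z !mulrA.
    by rewrite -(strand_commute _ _ SCx Sr) // !mulrA.
  apply: IH; first by lia.
  by apply: strandMoo => //; apply: strandMl.
have Fpj j : (p <= j <= q)%N -> red (F j - F p).
  case/andP=> pj; rewrite -(subnKC pj); elim: (j - p)%N => [|d IHd] d_le.
    by rewrite addn0 subrr; apply: red_0.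
  rewrite -(subrK (F (p + d)%N) (F _)) -addrA.
  apply: red_D; last by apply: IHd; lia.
  by rewrite addnS; apply: step; lia.
have {Fpj} GFq : red (F q - F p) by apply: Fpj; lia.
have GFp : red (F p - w * z).
  rewrite /F Tcycle_id mul1r -/w.
  have -> : w * z = w * C p * (z * C p).
    by rewrite -Cz; [rewrite -mulrA (mulrA (C p)) C_sq mul1r | lia].
  have -> : C p * w * C p * z = C p * (w * (C p * z)) by rewrite !mulrA.
  have -> : w * C p * (z * C p) = w * (C p * z) * C p by rewrite !mulrA.
  have SCz : strand 0 n true (C p * z).
    by apply: strandMr => //; apply: (strand_sub _ _ SCp) => //; lia.
  apply: red_comm; first by apply: (strand_subalg _ SCp); lia.
  apply: subalgM; first by apply: (strand_subalg _ Sw); lia.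
  exact: strand_subalg SCz.
have GFq' : red (F q + w * z).
  have -> : F q = - (w * C p * C q * z).
    rewrite /F Tcycle_id mulr1 -/w -(mulrA w) C_anti; [|lia..].
    by rewrite mulrN mulNr (mulrA w).
  rewrite addrC -[w * z]opprK -opprD addrC; apply: red_N.
  have odd_d : odd (q - p.+1) = false by lia.
  have -> : w * z = (-1) ^+ (q - p.+1) *: (w * z).
    by rewrite -signr_odd odd_d scale1r.
  by apply: Tcycle_CC_chain => //; lia.
have GFq_wz : red (F q - w * z).
  by rewrite -(subrK (F p) (F q)) -addrA; apply: red_D.
by apply: red_half; move: (red_B GFq' GFq_wz); rewrite opprB addrC addrA subrK.
Qed.

(** * The reduction *)

Lemma strand00 b x : strand 0 0 b x -> exists2 a, A a & x = a *: (1 : H).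
Proof.
elim=> {b x} [i _ //|j //||b x y _ [a Aa ->] _ [c Ac ->]|b a x Aa _ [c Ac ->]
             |b b' x y _ [a Aa ->] _ [c Ac ->]].
- by exists 1; rewrite ?scale1r.
- by exists (a - - c); [apply: A_B => //; apply: A_N | rewrite opprK scalerDl].
- by exists (a * c); [apply: A_M | rewrite scalerA].
- by exists (a * c); [apply: A_M | rewrite -hc_scalerAl mul1r scalerA].
Qed.

(** The list s holds the odd cycles found so far, on the top strands.  A cycle
    on the strands p, ..., m is grown below them while p decreases: in overlap
    its lowest strand is still shared with the remaining factor u, in disjoint
    it is not, and the cycle is put into s if it is odd, else shortened. *)
Lemma red_strand_blocks m s x : all odd s -> (m + sumn s)%N = n ->
  strand 0 m false x -> red (x * blocks m s).
Proof.
elim/ltn_ind: m s x => -[|m] IHm s x odd_s sum_s Sx.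
  have [a Aa ->] := strand00 Sx; rewrite -hc_scalerAl mul1r.
  by apply: red_Z => //; apply: red_odd_composition.
have Sy : strand m.+1 n false (blocks m.+1 s) by apply: strand_blocks; lia.
set y := blocks m.+1 s in Sy *.
have m_lt : (m < n)%N by lia.
have Ay : hc_subalg A y by apply: (strand_subalg _ Sy).
have disjoint p u : (p <= m)%N -> strand 0 p false u -> red (u * Tcycle p m * y).
  have [d] := ubnP (m - p); elim: d => // d IHd in p u *.
  rewrite ltnS => le_d pm Su.
  have [odd_d | even_d] := boolP (odd (m - p)).
    apply: red_even_cycle => // j w /andP[pj jm]; apply: IHd; lia.
  have -> : u * Tcycle p m * y = u * blocks p ((m - p).+1 :: s).
    by rewrite /= subnKC // addnS subnKC // mulrA.
  apply: IHm => //=; first by rewrite even_d.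
  by rewrite -sum_s; lia.
have overlap p u : (p <= m)%N -> strand 0 p.+1 false u -> red (u * Tcycle p m * y).
  elim/ltn_ind: p u => p IHp u pm Su.
  have p_lt : (p < n)%N by lia.
  have : ~~ false by []; elim: (strand_top_split p_lt Su) => {u Su}
    [b u Su|b u Su|q b b' u z Dp Su Sz|b u z _ IHu _ IHz] even_b.
  - by apply: disjoint => //; rewrite -(negbTE even_b).
  - have Sc : strand p n true (C p * Tcycle p m * y).
      apply: strandMr; last by apply: (strand_sub _ _ Sy) => //; lia.
      by apply: strandMr; [apply: strandC | apply: strand_Tcycle]; lia.
    rewrite -!mulrA [C p * _]mulrA; apply: (red_odd_odd _ _ Sc); first by lia.
    by rewrite -(negbNE even_b).
  - move: p_lt pm IHp Su Sz; rewrite {p}Dp => p_lt pm IHp Su Sz.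
    pose w := Tcycle q.+1 m * y.
    have Sw : strand q.+1 n false w.
      apply: strandMl; last by apply: (strand_sub _ _ Sy) => //; lia.
      by apply: strand_Tcycle; lia.
    have ST : strand 0 n false (T q) by apply: strandT; lia.
    have -> : u * T q * z * Tcycle q.+1 m * y = u * T q * w * z.
      by rewrite -mulrA -/w -mulrA (strand_commute _ _ Sz Sw) // mulrA.
    (* z is moved cyclically to the front, where it joins u. *)
    apply: red_cycle.
    + by apply: (strand_subalg _ Sz); lia.
    + apply: subalgM; last by apply: (strand_subalg _ Sw).
      apply: subalgM; last by apply: (strand_subalg _ ST).
      by apply: (strand_subalg _ Su); lia.
    have -> : z * (u * T q * w) = z * u * Tcycle q m * y.
      by rewrite (Tcycle_recl pm) /w !mulrA.
    apply: IHp => //; first exact: ltnW.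
    have -> : false = b' (+) b by case: (b) (b') even_b => [] [].
    exact: strandM.
  - by rewrite !mulrDl; apply: red_D; [apply: IHu | apply: IHz].
by have := overlap m x (leqnn m) Sx; rewrite Tcycle_id mulr1.
Qed.

Theorem red_even x : strand 0 n false x -> red x.
Proof.
move=> Sx; rewrite -[x]mulr1; have := @red_strand_blocks n [::] x isT.
by rewrite addn0; apply.
Qed.

End Membership.

(** * Existence of the coefficients *)

Lemma strand_T_perm (s : 'S_n) : strand 0 n false (T_perm v s).
Proof.
rewrite /T_perm; apply: (big_ind (strand 0 n false)).
- exact: strand1.
- by move=> x y; apply: strandMl.
by move=> i _; rewrite -hcT_natE; apply: strandT => //; apply: (ltn_ord (idxS i)).
Qed.

Lemma strand_C_set (I : {set 'I_n}) : strand 0 n (odd #|I|) (C_set v I).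
Proof.
rewrite /C_set cardE; elim: (enum I) => [|j s IHs].
  by rewrite big_nil; apply: strand1.
rewrite big_cons /= -addTb; apply: strandM => //.
by rewrite -hcC_natE; apply: strandC; rewrite ltn_ord.
Qed.

Local Notation commutators := (comm_span A (@hc_subalg _ v n A)).

Lemma comm_span_add x y : commutators x -> commutators y -> commutators (x + y).
Proof.
move=> Cx Cy; elim: Cx => [|a h h' z Aa Ah Ah' _ IHz]; first by rewrite add0r.
by rewrite -addrA; apply: comm_spanD.
Qed.

Lemma comm_span_scale a x : A a -> commutators x -> commutators (a *: x).
Proof.
move=> Aa; elim=> [|c h h' z Ac Ah Ah' _ IHz].
  by rewrite scaler0; apply: comm_span0.
by rewrite scalerDr scalerA; apply: comm_spanD => //; apply: A_M.
Qed.

Lemma comm_span1 x y :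
  hc_subalg A x -> hc_subalg A y -> commutators (x * y - y * x).
Proof.
move=> Ax Ay; rewrite -[_ - _]scale1r -[_ *: _]addr0.
by apply: comm_spanD => //; apply: comm_span0.
Qed.

(** The predicate of the previous part is the conclusion itself; it is closed
    under A-combinations because the coefficients are. *)
Lemma even_reduction x : A 2%:R^-1 -> 2%:R != 0 :> K ->
    strand 0 n false x ->
  exists f : n.-bseq 'I_n.+1 -> K,
    (forall nu, nu \in odd_part n -> A (f nu)) /\
    comm_even A (x - \sum_(nu in odd_part n) f nu *: T_comp v (parts nu)).
Proof.
move=> A_half two_neq0 Sx.
pose S (f : n.-bseq 'I_n.+1 -> K) : H :=
  \sum_(nu in odd_part n) f nu *: T_comp v (parts nu).
pose red y := exists2 f, forall nu, A (f nu) & commutators (y - S f).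
suff [f Af Cf] : red x.
  exists f; split=> //; split=> //.
  apply: (@strand_homog 0 n) => //; apply: strandB => //.
  apply: (big_ind (strand 0 n false)).
  - by have := strandZ A_0 (strand1 0 n); rewrite scale0r.
  - by move=> y z; apply: strandD.
  move=> nu; rewrite inE => /and3P[_ _ /eqP sum_nu]; apply: strandZ => //.
  by rewrite T_comp_blocks; apply: strand_blocks; rewrite ?sum_nu.
apply: red_even Sx => // [y z [f Af Cf] [g Ag Cg]|a y Aa [f Af Cf]|y z Ay Az|s].
- exists (fun nu => f nu + g nu).
    by move=> nu; rewrite -[g nu]opprK; apply: A_B => //; apply: A_N.
  have -> : S (fun nu => f nu + g nu) = S f + S g.
    by rewrite /S -big_split; apply: eq_bigr => nu _; rewrite scalerDl.
  by rewrite opprD addrACA; apply: comm_span_add.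
- exists (fun nu => a * f nu); first by move=> nu; apply: A_M.
  have -> : S (fun nu => a * f nu) = a *: S f.
    by rewrite /S scaler_sumr; apply: eq_bigr => nu _; rewrite scalerA.
  by rewrite -scalerBr; apply: comm_span_scale.
- exists (fun=> 0) => [_|]; first exact: A_0.
  have -> : S (fun=> 0) = 0 by rewrite /S big1 // => nu _; rewrite scale0r.
  by rewrite subr0; apply: comm_span1.
case/odd_partP=> nu nu_odd <-; exists (fun mu => (mu == nu)%:R).
  by move=> mu; case: eqP => _; [apply: A_1 | apply: A_0].
rewrite /S (bigD1 nu) //= eqxx scale1r big1 ?addr0 ?subrr.
  exact: comm_span0.
by move=> mu /andP[_ /negbTE->]; rewrite scale0r.
Qed.

End TraceReduction.

Lemma two_neq0_Cv (R : realType) : 2%:R != 0 :> Cv R.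
Proof.
rewrite -(rmorph_nat (@tofrac {poly R[i]})) tofrac_eq0 -polyC_natr polyC_eq0.
by rewrite Num.Theory.pnatr_eq0.
Qed.

Lemma ind_v_neq0 (R : realType) : ind_v R != 0.
Proof. by rewrite /ind_v expf_neq0 // /sqrt_v tofrac_eq0 polyX_eq0. Qed.

Theorem theorem4p7 (R : realType) (n : nat) (hn : (1 <= n)%N)
  (sigma : 'S_n) (I : {set 'I_n}) (hI : ~~ odd #|I|) :
  exists f : n.-bseq 'I_n.+1 -> Cv R,
    (forall nu, nu \in odd_part n -> ringA (f nu)) /\
    comm_even (@ringA R)
      (T_perm (ind_v R) sigma * C_set (ind_v R) I
       - \sum_(nu in odd_part n) f nu *: T_comp (ind_v R) (parts nu)).
Proof.
apply: even_reduction.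
- exact: ind_v_neq0.
- exact: sgen1.
- exact: sgenB.
- exact: sgenM.
- by apply: sgen_in; apply: Or32.
- by apply: sgen_in; apply: Or33.
- by apply: sgen_in; apply: Or31.
- exact: two_neq0_Cv.
apply: strandMl; first exact: strand_T_perm.
by rewrite -(negbTE hI); apply: strand_C_set.
Qed.
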